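(* For every real $\alpha$ with $-1<\alpha\le 1$, $$\int_0^\infty\frac{\log(1+\alpha x)}{x(1+x)}\,dx=\log\alpha\,\log(1-\alpha)+\mathrm{Li}_2(\alpha),$$ where $\log$ is the principal branch of the logarithm and the product $\log\alpha\,\log(1-\alpha)$ is understood as its limiting value $0$ at $\alpha=0$ and at $\alpha=1$.
   Context: $\mathrm{Li}_2(\alpha)=\sum_{n=1}^\infty\frac{\alpha^n}{n^2}$ for $|\alpha|\le 1$ is the dilogarithm. The principal branch of the logarithm satisfies $\log y=\log|y|+i\pi$ for real $y<0$; for $-1<\alpha<0$ the quantities $\log\alpha$ and $\log(1+\alpha x)$ with $x>-1/\alpha$ are taken in this sense. *)

(* Defs.v *)
From HB Require Import structures.
From mathcomp Require Import all_boot all_order all_algebra.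
From mathcomp Require Import all_classical all_reals all_analysis.
From mathcomp Require Import complex.

Set Implicit Arguments.
Unset Strict Implicit.
Unset Printing Implicit Defensive.

Import Order.TTheory GRing.Theory Num.Theory.
Import numFieldNormedType.Exports.
Import ComplexField.

Local Open Scope classical_set_scope.
Local Open Scope ring_scope.
Local Open Scope complex_scope.

(* Principal argument, with values in ]-pi, pi]; the value at 0 is irrelevant. *)
Definition Carg (R : realType) (z : R[i]) : R :=
  let t := acos (complex.Re z / Normc.normc z) in
  if 0 <= complex.Im z then t else - t.

Definition Clog (R : realType) (z : R[i]) : R[i] :=
  ln (Normc.normc z) +i* Carg z.

Lemma Clog_pos (R : realType) (x : R) : 0 < x -> Clog x%:C = (ln x)%:C.
Proof.
move=> x0; rewrite /Clog /Carg /Normc.normc /= lexx expr0n addr0 sqrtr_sqr.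
by rewrite gtr0_norm// divff ?gt_eqF// acos1.
Qed.

Lemma Clog_neg (R : realType) (x : R) :
  x < 0 -> Clog x%:C = (ln `|x|)%:C + 'i * pi%:C.
Proof.
move=> x0; rewrite /Clog /Carg /Normc.normc /= lexx expr0n addr0 sqrtr_sqr.
rewrite ltr0_norm// invrN mulrN divff ?lt_eqF// acosN1.
by simpc.
Qed.

Definition Li2 (R : realType) (a : R) : R :=
  limn (fun N => \sum_(1 <= n < N.+1) a ^+ n / n%:R ^+ 2).

(* log a * log (1 - a), extended by its limiting value 0 at a = 0 and a = 1,
   where one of the logarithms is undefined. *)
Definition log_log1B (R : realType) (a : R) : R[i] :=
  if (a == 0) || (a == 1) then 0 else Clog a%:C * Clog (1 - a)%:C.

Section complex_integral.
Context d (T : measurableType d) (R : realType).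
Variables (mu : {measure set T -> \bar R}) (D : set T) (f : T -> R[i]).

Definition Cintegrable : Prop :=
  mu.-integrable D (fun x => (complex.Re (f x))%:E) /\
  mu.-integrable D (fun x => (complex.Im (f x))%:E).

Definition Cintegral : R[i] :=
  (\int[mu]_(x in D) complex.Re (f x)) +i* (\int[mu]_(x in D) complex.Im (f x)).

End complex_integral.

(* At the single point x = - 1 / a (when a < 0), which is Lebesgue-null,
   the logarithm takes the irrelevant value Clog 0. *)
Definition integrand (R : realType) (a x : R) : R[i] :=
  Clog (1 + a * x)%:C / (x * (1 + x))%:C.

(* Main.v *)
Require Import Defs.
From mathcomp Require Import all_boot all_order all_algebra.
From mathcomp Require Import all_classical all_reals all_analysis.
From mathcomp Require Import complex.
From mathcomp Require Import measurable_realfun ring lra.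

Import Order.TTheory GRing.Theory Num.Theory.
Import numFieldNormedType.Exports.

Local Open Scope classical_set_scope.
Local Open Scope ring_scope.
Local Open Scope complex_scope.

Set Implicit Arguments.
Unset Strict Implicit.
Unset Printing Implicit Defensive.

(* The substitution t = x / (1 + x) turns dx / (x (1 + x)) into dt / t and
   1 + a x into (1 - (1 - a) t) / (1 - t), so the real part of the integral is
   M (1 - a) - M 1 for a primitive M of ln |1 - y| / y. Euler's reflection formula
   provides one on all of ]0, 2[ while only evaluating Li2 inside its disc of
   convergence:
   M y = ln |y| ln |1 - y| + Li2 (1 - y). It extends continuously through the
   logarithmic singularity y = 1, which corresponds to x = - 1 / a.
   Integrability comes for free: on each interval where the integrand has constant
   sign, monotone convergence along an exhaustion by segments reduces everything
   to boundary values of the primitive. The imaginary part is pi times the integral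
   of 1 / (x (1 + x)) over ]- 1 / a, +oo[. *)

(** By Bernoulli's inequality, (n + 1) d <= (1 + d)^n, and d is small enough for (1 + d) |x| < 1, so
    a geometric series dominates. A linear bound is what the series below and their first two formal
    derivatives all satisfy. *)
Lemma is_cvg_pseries_linear (R : realType) (c : R^nat) (x : R) :
  (forall n, `|c n| <= n.+1%:R) -> `|x| < 1 -> cvgn (pseries c x).
Proof.
move=> cn x1; pose d := (1 - `|x|) / 2.
have d0 : 0 < d by rewrite /d; lra.
have [x0 d1] : 0 <= `|x| /\ d <= 1 by split=> //; rewrite /d; have := normr_ge0 x; lra.
have q1 : (1 + d) * `|x| < 1 by rewrite /d; nra.
apply: normed_cvg.
apply: (@series_le_cvg _ _ (geometric d^-1 ((1 + d) * `|x|))) => [n|n|n|] /=.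
- exact: normr_ge0.
- by rewrite mulr_ge0 ?invr_ge0 ?exprn_ge0 ?mulr_ge0 ?(ltW d0)//; lra.
- rewrite normrM normrX exprMn mulrA ler_wpM2r ?exprn_ge0//.
  apply: (le_trans (cn n)); rewrite mulrC ler_pdivlMr//.
  elim: n => [|n IH]; first by rewrite expr0 mul1r.
  rewrite exprS -natr1 mulrDl mul1r.
  have : 1 <= (1 + d) ^+ n by rewrite exprn_ege1//; lra.
  nra.
- apply: is_cvg_geometric_series; rewrite ger0_norm ?mulr_ge0//; lra.
Qed.

(** * The dilogarithm as a power series: derivative inside the disc, continuity at 1 *)

Section dilogarithm.
Context {R : realType}.
Implicit Types x y u : R.

(* As 0^-1 = 0, both coefficient sequences vanish at index 0. *)
Let c2 (n : nat) : R := n%:R ^- 2.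
Let c1 (n : nat) : R := n%:R^-1.

Lemma Li2_pseries u : Li2 u = limn (pseries c2 u).
Proof.
(* The term of index 0 vanishes, so the sum from 1 to N is the partial sum with N + 1 terms. *)
have E : (fun N => \sum_(1 <= n < N.+1) u ^+ n / n%:R ^+ 2) =
         [sequence (pseries c2 u) n.+1]_n.
  apply/funext => N /=; rewrite /pseries /series /= [RHS]big_nat_recl//.
  rewrite /c2 mulr0n expr0n invr0 mul0r add0r big_add1 /=.
  by apply: eq_bigr => i _; rewrite mulrC.
(* Convergence is not known for arbitrary u; the limits agree because a sequence and its shift
   converge to the same points. *)
rewrite /Li2 E /lim; congr get; apply/funext => l.
by rewrite /= [LHS]cvg_shiftS.
Qed.

Lemma norm_invn_le (m n : nat) : `|(n%:R ^+ m)^-1 : R| <= n.+1%:R.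
Proof.
rewrite ger0_norm ?invr_ge0 ?exprn_ge0//.
case: m => [|m]; first by rewrite expr0 invr1 ler1n.
case: n => [|n]; first by rewrite expr0n invr0.
apply: (@le_trans _ _ 1); last by rewrite ler1n.
by rewrite invf_le1 ?exprn_gt0 ?ltr0n// exprn_ege1// ler1n.
Qed.

Let c1_diffs : pseries_diffs c1 = fun _ => 1.
Proof. by apply/funext => n; rewrite /pseries_diffs /c1 divff// pnatr_eq0. Qed.

Let c2_diffs : pseries_diffs c2 = fun n => c1 n.+1.
Proof.
apply/funext => n; rewrite /pseries_diffs /c2 /c1 expr2 invfM mulrA divff ?mul1r//.
Qed.

Let cvg_c1 u : `|u| < 1 -> cvgn (pseries c1 u).
Proof. by apply: is_cvg_pseries_linear => n; exact: (norm_invn_le 1). Qed.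

Let cvg_c2 u : `|u| < 1 -> cvgn (pseries c2 u).
Proof. by apply: is_cvg_pseries_linear => n; exact: (norm_invn_le 2). Qed.

(** Termwise differentiation at u asks for convergence at a point of larger modulus. *)
Let mid u : `|u| < 1 -> exists2 K : R, `|u| < `|K| & `|K| < 1.
Proof.
move=> u1; exists ((`|u| + 1) / 2); have := normr_ge0 u; move=> u0.
  by rewrite [ltRHS]ger0_norm; lra.
by rewrite ger0_norm; lra.
Qed.

Lemma is_derive_pseries_invn u : `|u| < 1 ->
  is_derive u 1 (fun x => limn (pseries c1 x)) (1 - u)^-1.
Proof.
move=> u1; have [K uK K1] := mid u1.
have -> : (1 - u)^-1 = limn (pseries (pseries_diffs c1) u).
  apply/esym/cvg_lim => //.
  rewrite c1_diffs -[X in _ --> X]mul1r; exact: cvg_geometric_series.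
apply: (@pseries_snd_diffs _ _ K) => //.
- exact: cvg_c1.
- apply: is_cvg_pseries_linear => // n; rewrite c1_diffs normr1 ler1n//.
- apply: is_cvg_pseries_linear => // n; rewrite c1_diffs /pseries_diffs mulr1.
  by rewrite ger0_norm.
Qed.

Lemma is_derive1_ln1B u : u < 1 -> is_derive u 1 (fun x : R => ln (1 - x)) (- (1 - u)^-1).
Proof.
move=> u1; have u0 : 0 < 1 - u by lra.
have -> : - (1 - u)^-1 = (1 - u)^-1 * (0 - 1) by rewrite sub0r mulrN1.
apply: (@is_derive1_comp _ (@ln R) (fun x => 1 - x)); first exact: is_derive1_ln.
Qed.

(** The difference [g] of the two sides has zero derivative on ]-1, 1[ and vanishes at 0; the mean
    value theorem makes it constant. *)
Lemma pseries_invn u : `|u| < 1 -> limn (pseries c1 u) = - ln (1 - u).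
Proof.
move=> u1; pose g x := limn (pseries c1 x) + ln (1 - x).
have dg x : `|x| < 1 -> is_derive x 1 g 0.
  move=> x1; rewrite -[X in is_derive _ _ _ X](subrr (1 - x)^-1).
  apply: is_deriveD; first exact: is_derive_pseries_invn.
  by apply: is_derive1_ln1B; case/ltr_normlP : x1; lra.
have g0 : g 0 = 0.
  rewrite /g subr0 ln1 addr0; apply/cvg_lim => //.
  have -> : pseries c1 0 = fun _ => 0.
    apply/funext => n; rewrite /pseries /series /= big1// => -[|i] _.
      by rewrite /c1 invr0 mul0r.
    by rewrite expr0n mulr0.
  exact: cvg_cst.
have gconst x y : x <= y -> `|x| < 1 -> `|y| < 1 -> g x = g y.
  move=> xy x1 y1.
  have H z : z \in `[x, y] -> is_derive z 1 g 0.
    rewrite in_itv /= => /andP[xz zy]; apply: dg.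
    by move: x1 y1; rewrite !ltr_norml; lra.
  have H' z : z \in `]x, y[ -> is_derive z 1 g 0.
    by move=> zxy; apply: H; exact: subset_itv_oo_cc.
  have cg : {within `[x, y], continuous g}.
    by apply: derivable_within_continuous => z /H[].
  have [z _] := @MVT_segment _ g (fun _ => 0) _ _ xy H' cg.
  by rewrite mul0r => /eqP; rewrite subr_eq0 => /eqP.
have : g u = 0.
  have [u0|/ltW u0] := leP u 0; [rewrite (gconst u 0)|rewrite -(gconst 0 u)];
    by rewrite // normr0.
by rewrite /g => /eqP; rewrite addr_eq0 => /eqP.
Qed.

Lemma is_derive_Li2_pseries u : `|u| < 1 ->
  is_derive u 1 (@Li2 R) (limn (pseries (pseries_diffs c2) u)).
Proof.
move=> u1; have [K uK K1] := mid u1.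
rewrite (funext Li2_pseries).
apply: (@pseries_snd_diffs _ _ K) => //.
- exact: cvg_c2.
- apply: is_cvg_pseries_linear => // n; rewrite c2_diffs /c1.
  rewrite ger0_norm// (@le_trans _ _ 1)// ?ler1n// invf_le1 ?ltr0n// ler1n//.
- apply: is_cvg_pseries_linear => // n; rewrite c2_diffs /pseries_diffs /c1.
  rewrite ger0_norm ?divr_ge0// ler_pdivrMr ?ltr0n//.
  by rewrite -natrM ler_nat leq_pmulr.
Qed.

(** Multiplied by u, the differentiated series is the series of -ln (1 - u) shifted by one index. *)
Lemma is_derive_Li2 u : `|u| < 1 -> u != 0 ->
  is_derive u 1 (@Li2 R) (- ln (1 - u) / u).
Proof.
move=> u1 u0; suff -> : - ln (1 - u) / u = limn (pseries (pseries_diffs c2) u).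
  exact: is_derive_Li2_pseries.
apply/(mulIf u0); rewrite divfK// -pseries_invn//; apply/cvg_lim => //.
rewrite -cvg_shiftS /=.
have -> : (fun n => pseries c1 u n.+1) = (fun n => pseries (pseries_diffs c2) u n * u).
  apply/funext => n; rewrite /pseries /series /= big_nat_recl//.
  rewrite /c1 invr0 mul0r add0r mulr_suml c2_diffs.
  by apply: eq_bigr => i _; rewrite exprSr mulrA.
apply: cvgMr_tmp.
apply: is_cvg_pseries_linear u1 => n; rewrite c2_diffs /c1.
by rewrite ger0_norm// (@le_trans _ _ 1)// ?ler1n// invf_le1 ?ltr0n// ler1n.
Qed.

Lemma continuous_Li2 u : `|u| < 1 -> {for u, continuous (@Li2 R)}.
Proof.
move=> u1; apply/differentiable_continuous/derivable1_diffP.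
by have [] := is_derive_Li2_pseries u1.
Qed.

(** Telescoping: with m = n + 1, the new term 1 / (m + 1)^2 is at most 1 / (m (m + 1)) = 1 / m - 1 /
    (m + 1). *)
Let sum_c2_le n : \sum_(0 <= k < n.+2) c2 k <= 2 - n.+1%:R^-1.
Proof.
elim: n => [|n IH].
  rewrite !big_nat_recr//= big_nil /c2 expr0n expr1n invr0 !invr1 !add0r.
  by rewrite lerBrDr.
rewrite big_nat_recr//= (le_trans (lerD IH (lexx _)))// /c2.
have n0 : (0 : R) < n.+1%:R by rewrite ltr0n.
rewrite -[n.+2%:R]natr1; set m : R := n.+1%:R in n0 *.
rewrite -addrA lerD2l -lerBrDl opprK [leRHS]addrC.
have -> : m^-1 - (m + 1)^-1 = (m * (m + 1))^-1 by field; lra.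
by rewrite lef_pV2 ?posrE ?exprn_gt0 ?mulr_gt0//; nra.
Qed.

Let pseries_c2_nd x : 0 <= x -> nondecreasing_seq (pseries c2 x).
Proof.
move=> x0; apply/nondecreasing_seqP => n.
by rewrite /pseries /series /= big_nat_recr//= lerDl mulr_ge0 ?exprn_ge0 ?invr_ge0.
Qed.

Let pseries_c2_le x y n : 0 <= x <= y -> pseries c2 x n <= pseries c2 y n.
Proof.
move=> /andP[x0 xy]; rewrite /pseries /series /=; apply: ler_sum => i _.
by rewrite ler_wpM2l ?invr_ge0 ?exprn_ge0// lerXn2r// nnegrE (le_trans x0).
Qed.

Let cvg_c2_1 : cvgn (pseries c2 1).
Proof.
apply: nondecreasing_is_cvgn; first exact: pseries_c2_nd.
exists 2 => _ [n _ <-].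
apply: (@le_trans _ _ (pseries c2 1 n.+2)).
  by apply: pseries_c2_nd => //; rewrite -addn2 leq_addr.
rewrite /pseries /series /=; under eq_bigr do rewrite expr1n mulr1.
by rewrite (le_trans (sum_c2_le n))// gerBl.
Qed.

(** All terms are nonnegative, so Li2 (1 - |y|) lies between its N-th partial sum and Li2 1. That
    partial sum is continuous in y and, for a suitable N, within e / 2 of Li2 1 at y = 0. *)
Lemma Li2_left_continuous1 : Li2 (1 - `|y|) @[y --> (0 : R)] --> Li2 (1 : R).
Proof.
have [P1 P2] := (Li2_pseries 1, cvg_c2_1).
apply/cvgrPdist_le => e e0; have e2 : 0 < e / 2 by lra.
have /cvgrPdist_lt /(_ _ e2)[N _ /(_ N (leqnn N)) HN] : pseries c2 1 @ \oo --> Li2 1.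
  by rewrite P1; exact: P2.
have cN : (fun y : R => pseries c2 (1 - `|y|) N) y @[y --> 0] --> pseries c2 1 N.
  rewrite -[X in _ --> pseries c2 X N](subr0 1).
  rewrite -[X in _ --> pseries c2 (1 - X) N](normr0 R).
  rewrite /pseries /series /=; apply: cvg_big; first exact: add_continuous.
  move=> i _.
  apply: cvgMl_tmp.
  apply: (@continuous_comp _ _ _ (fun y : R => 1 - `|y|) (fun x => x ^+ i));
    last exact: exprn_continuous.
  apply: cvgB; [exact: cvg_cst|exact: norm_continuous].
move/cvgrPdist_lt : cN => /(_ _ e2) cN.
near=> y.
have y1 : `|y| < 1 by near: y; exact: (@pseudometric_normed_Zmodule.nbhs0_lt _ R^o).
have cy : cvgn (pseries c2 (1 - `|y|)).
  have [->|y0] := eqVneq y 0; first by rewrite normr0 subr0.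
  by apply: cvg_c2; rewrite ger0_norm; move: y0; rewrite -normr_gt0; lra.
have Nle : pseries c2 (1 - `|y|) N <= Li2 (1 - `|y|).
  by rewrite Li2_pseries; apply: nondecreasing_cvgn_le cy _; apply: pseries_c2_nd; lra.
have le1 : Li2 (1 - `|y|) <= Li2 1.
  rewrite !Li2_pseries; apply: ler_lim => //; near=> n.
  by apply: pseries_c2_le; have := normr_ge0 y; lra.
rewrite ger0_norm ?subr_ge0//.
have : `|pseries c2 1 N - pseries c2 (1 - `|y|) N| < e / 2 by near: y.
move: HN => /ltr_normlP[_ H1] /ltr_normlP[_ H2].
lra.
Unshelve. all: by end_near. Qed.

End dilogarithm.

(** * A continuous primitive of ln |1 - y| / y from the reflection formula *)

Section antiderivative.
Context {R : realType}.
Implicit Types x y u : R.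

Lemma is_derive1_ln_norm x : x != 0 -> is_derive x 1 (fun y : R => ln `|y|) x^-1.
Proof.
case: ltgtP => // x0 _.
- apply: (@near_eq_is_derive _ _ _ (@ln R \o -%R)).
    by near=> y; rewrite /= ltr0_norm//; near: y; exact: lt_nbhsl.
  rewrite (_ : x^-1 = (- x)^-1 * -1); last by field; lra.
  by apply: is_derive1_comp; apply: is_derive1_ln; lra.
- apply: (@near_eq_is_derive _ _ _ (@ln R)); last exact: is_derive1_ln.
  by near=> y; rewrite /= gtr0_norm//; near: y; exact: lt_nbhsr.
Unshelve. all: by end_near. Qed.

Lemma is_derive1_ln_norm_comp (g : R -> R) x (b : R) :
  g x != 0 -> is_derive x 1 g b ->
  is_derive x 1 (fun y : R => ln `|g y|) ((g x)^-1 * b).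
Proof.
move=> gx dg.
exact: (@is_derive1_comp _ (fun y => ln `|y|) g _ _ _ (is_derive1_ln_norm gx) dg).
Qed.

Lemma continuous_ln_norm x : x != 0 -> {for x, continuous (fun y : R => ln `|y|)}.
Proof.
move=> x0; apply/differentiable_continuous/derivable1_diffP.
by have [] := is_derive1_ln_norm x0.
Qed.

(* Since ln 0 = 0, the junk values of log_prod at 0 and 1 are its limits there. *)
Definition log_prod y : R := ln `|y| * ln `|1 - y|.

(** With s the square root of |y|, the factors are bounded by 2 / s and 2 s^2. *)
Lemma norm_log_prod_le y : `|y| <= 1 / 2 -> `|log_prod y| <= 4 * Num.sqrt `|y|.
Proof.
rewrite /log_prod; have [->|y0] := eqVneq y 0.
  by rewrite normr0 ln0// mul0r normr0 sqrtr0 mulr0.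
move=> /[dup] y12 /ler_normlP[y1 y2]; rewrite normrM.
have y0' : 0 < `|y| by rewrite normr_gt0.
have s0 : 0 < Num.sqrt `|y| by rewrite sqrtr_gt0.
have sE := sqr_sqrtr (ltW y0'); set s := Num.sqrt _ in s0 sE *.
(* Here -ln |y| = 2 ln (1 / s), and a logarithm is smaller than its argument. *)
have l1 : `|ln `|y| | <= 2 / s.
  rewrite ler0_norm; last by apply: ln_le0; lra.
  rewrite -sE lnXn// -mulNrn -lnV// -[leLHS]mulr_natl ler_pM2l//.
  by rewrite ltW// ln_sublinear// invr_gt0.
have l2 : `|ln `|1 - y| | <= 2 * `|y|.
  rewrite (@gtr0_norm _ (1 - y)); last by lra.
  apply/ler_normlP; split; last first.
    apply: (@le_trans _ _ (- y)); first by apply: le_ln1Dx; lra.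
    by rewrite (le_trans (ler_norm _))// normrN; lra.
  (* The lower bound comes from -ln (1 - y) = ln (1 + y / (1 - y)) <= y / (1 - y), where 1 - y >= 1
     / 2. *)
  rewrite -lnV ?posrE; last by lra.
  rewrite (_ : (1 - y)^-1 = 1 + y / (1 - y)); last by field; lra.
  have : ln (1 + y / (1 - y)) <= y / (1 - y).
    by apply: le_ln1Dx; rewrite ltr_pdivlMr; lra.
  move=> /le_trans; apply; rewrite ler_pdivrMr; last by lra.
  have := ler_norm y; nra.
apply: (le_trans (ler_pM (normr_ge0 _) (normr_ge0 _) l1 l2)).
rewrite -sE (_ : 2 / s * (2 * s ^+ 2) = 4 * s)//; field; lra.
Qed.

Lemma continuous_log_prod0 : {for 0, continuous log_prod}.
Proof.
have L0 : log_prod 0 = 0 by rewrite /log_prod normr0 ln0// mul0r.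
rewrite /prop_for /continuous_at L0; apply/cvgr0Pnorm_le => e e0.
have c0 : {for (0 : R), continuous (fun y : R => Num.sqrt `|y|)}.
  apply: (@continuous_comp _ _ _ (fun y : R => `|y|) Num.sqrt).
    exact: norm_continuous.
  exact: sqrt_continuous.
have c : 4 * Num.sqrt `|y| @[y --> (0 : R)] --> 4 * Num.sqrt `|0 : R|.
  exact: cvgMl_tmp.
rewrite normr0 sqrtr0 mulr0 in c.
move/cvgr0Pnorm_le : c => /(_ _ e0) c.
near=> y.
have h : `|y| < 1 / 2.
  by near: y; apply: (@pseudometric_normed_Zmodule.nbhs0_lt _ R^o).
apply: (le_trans (norm_log_prod_le (ltW h))).
by apply: le_trans (ler_norm _) _; near: y.
Unshelve. all: by end_near. Qed.

Lemma log_prodB1 y : log_prod (1 - y) = log_prod y.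
Proof. by rewrite /log_prod mulrC opprB addrC subrK. Qed.

(** The delicate points are 0, settled by the square root bound, and 1, which the symmetry y -> 1 -
    y carries to 0. *)
Lemma continuous_log_prod y : {for y, continuous log_prod}.
Proof.
have [->|y0] := eqVneq y 0; first exact: continuous_log_prod0.
have c1B : {for y, continuous (fun z : R => 1 - z)}.
  by apply: cvgB; [exact: cvg_cst|exact: cvg_id].
have [y1|y1] := eqVneq (1 - y) 0.
  rewrite -(funext log_prodB1).
  apply: (@continuous_comp _ _ _ (fun z : R => 1 - z) log_prod) => //.
  rewrite y1; exact: continuous_log_prod0.
apply: cvgM; first exact: continuous_ln_norm.
apply: (@continuous_comp _ _ _ (fun z : R => 1 - z) (fun z : R => ln `|z|)) => //.
exact: continuous_ln_norm.
Qed.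

(* Equal to Li2 1 - Li2 y for y in [0, 1], by Euler's reflection formula. *)
Definition Li2_refl y : R := log_prod y + Li2 (1 - `|y|).

(** The argument 1 - |y| stays in ]-1, 1] and reaches 1 only at y = 0. The absolute value turns left
    continuity of Li2 at 1 into two-sided continuity there. *)
Lemma continuous_Li2_refl y : `|y| < 2 -> {for y, continuous Li2_refl}.
Proof.
move=> y2; apply: cvgD; first exact: continuous_log_prod.
have [->|y0] := eqVneq y 0.
  by rewrite normr0 subr0; exact: Li2_left_continuous1.
apply: (@continuous_comp _ _ _ (fun z : R => 1 - `|z|) (@Li2 R)).
  by apply: cvgB; [exact: cvg_cst|exact: norm_continuous].
apply: continuous_Li2; apply/ltr_normlP.
by move: y0; rewrite -normr_gt0; split; lra.
Qed.

(** The product of logarithms contributes ln |1 - y| / y - ln y / (1 - y), and Li2 (1 - y)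
    contributes ln y / (1 - y), which cancels the second term. *)
Lemma is_derive_Li2_refl y : 0 < y < 2 -> y != 1 ->
  is_derive y 1 Li2_refl (ln `|1 - y| / y).
Proof.
move=> /andP[y0 y2] y1.
have y1' : 1 - y != 0 by rewrite subr_eq0 eq_sym.
apply: (@near_eq_is_derive _ _ _ (fun z : R => ln `|z| * ln `|1 - z| + Li2 (1 - z))).
  near=> z; rewrite /Li2_refl /log_prod; congr (_ + Li2 (1 - _)).
  by rewrite gtr0_norm//; near: z; exact: lt_nbhsr.
have d1 : is_derive y 1 (fun z : R => 1 - z) (0 - 1) by exact: is_deriveB.
have dL : is_derive (1 - y) 1 (@Li2 R) (- ln (1 - (1 - y)) / (1 - y)).
  by apply: is_derive_Li2 => //; apply/ltr_normlP; split; lra.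
have dLc := @is_derive1_comp _ (@Li2 R) (fun z : R => 1 - z) y _ _ dL d1.
have dl := @is_derive1_ln_norm_comp (fun z : R => 1 - z) y _ y1' d1.
have dP := is_deriveM (is_derive1_ln_norm (lt0r_neq0 y0)) dl.
apply: (is_derive_eq (is_deriveD dP dLc)).
rewrite /GRing.scale /= (gtr0_norm y0) subKr.
field.
by rewrite y1' gt_eqF.
Unshelve. all: by end_near. Qed.

End antiderivative.

(** * Integrals over open intervals from boundary values of a primitive *)

Section has_integral.
Context {R : realType}.
Notation mu := (@lebesgue_measure R).
Implicit Types (D : set R) (f F : R -> R).

(** Integrability is bundled in because the real-valued integral returns a default value when the
    extended one is infinite. *)
Definition has_integral D f (v : R) :=
  mu.-integrable D (EFin \o f) /\ \int[mu]_(x in D) f x = v.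

(** The fundamental theorem gives F (w n) - F (u n) on each segment; as f >= 0, these values also
    converge to the integral over [D]. Its finiteness is then the integrability. *)
Lemma has_integral_exhaustion D f F (u w : R^nat) (lu lw : R) :
  open D -> (forall x, D x -> 0 <= f x) ->
  (forall x, D x -> {for x, continuous f}) ->
  (forall x, D x -> is_derive x 1 F (f x)) ->
  {homo u : m n / (m <= n)%N >-> n <= m} ->
  {homo w : m n / (m <= n)%N >-> m <= n} ->
  (forall n, u n < w n) -> (forall n, `[u n, w n] `<=` D) ->
  (forall x, D x -> \forall n \near \oo, u n <= x <= w n) ->
  F (u n) @[n --> \oo] --> lu -> F (w n) @[n --> \oo] --> lw ->
  has_integral D f (lw - lu).
Proof.
move=> oD f0 cf dF u_ni w_nd uw uwD Dcov Flu Flw.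
have DE : D = \bigcup_n `[u n, w n]%classic.
  apply/seteqP; split => [x Dx|x [n _]]; last exact: uwD.
  have [N _ /(_ N (leqnn N)) /= HN] := Dcov _ Dx.
  by exists N => //=; rewrite in_itv.
have mD : measurable D by exact: open_measurable.
have mf : measurable_fun D f.
  apply: open_continuous_measurable_fun => // x.
  by rewrite inE => /cf.
have mfn n : measurable_fun `[u n, w n]%classic (EFin \o f).
  by apply/measurable_EFinP; apply: measurable_funS mf => //; exact: uwD.
have cFs n x : x \in `[u n, w n] -> {for x, continuous F}.
  move=> xn; apply/differentiable_continuous/derivable1_diffP.
  by have [] := dF x (uwD n x xn).
have ftc n : (\int[mu]_(x in `[u n, w n]) (f x)%:E = (F (w n) - F (u n))%:E)%E.
  rewrite EFinB; apply: continuous_FTC2 => //.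
  - by apply: continuous_in_subspaceT => x; rewrite inE => /uwD/cf.
  - split.
    + by move=> x /subset_itv_oo_cc/uwD/dF[].
    + apply: cvg_at_right_filter; apply: (cFs n).
      by rewrite in_itv/= lexx ltW.
    + apply: cvg_at_left_filter; apply: (cFs n).
      by rewrite in_itv/= lexx ltW.
  - move=> x /subset_itv_oo_cc/uwD/dF[_ <-]; exact: derive1E.
have nd : nondecreasing_seq (fun n => `[u n, w n]%classic : set R).
  move=> m n mn; apply/subsetPset; apply: subset_itv; rewrite bnd_simp.
    exact: u_ni.
  exact: w_nd.
have intf : (\int[mu]_(x in D) (f x)%:E = (lw - lu)%:E)%E.
  have c1 : (\int[mu]_(x in `[u n, w n]) (f x)%:E)%E @[n --> \oo] -->
      (\int[mu]_(x in D) (f x)%:E)%E.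
    rewrite [in X in _ --> X]DE.
    apply: (@ge0_nondecreasing_set_cvg_integral _ (measurableTypeR R) R
      (fun n => `[u n, w n]%classic) (EFin \o f) mu) => // n x /uwD/f0.
    by rewrite lee_fin.
  have c2 : (\int[mu]_(x in `[u n, w n]) (f x)%:E)%E @[n --> \oo] --> (lw - lu)%:E.
    under eq_cvg do rewrite ftc.
    by apply: cvg_EFin; [exact: nearW|exact: cvgB].
  exact: cvg_unique c1 c2.
split; last by rewrite /Rintegral intf.
apply/integrableP; split; first exact/measurable_EFinP.
under eq_integral => x /[!inE] /f0 fx do rewrite /= ger0_norm//.
by rewrite intf ltry.
Qed.

Let harmonic01 n : 0 < @harmonic R n <= 1.
Proof. by rewrite /harmonic /= invr_gt0 ltr0n/= invf_le1 ?ltr0n// ler1n. Qed.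

Let harmonic_ni m n : (m <= n)%N -> @harmonic R n <= harmonic m.
Proof. by move=> mn; rewrite /harmonic /= lef_pV2 ?posrE ?ltr0n// ler_nat. Qed.

(** Only [F] has to be continuous at the end points; [f] may be singular there. *)
Lemma has_integral_oo f F (p q : R) : p < q ->
  (forall x, p < x < q -> 0 <= f x) ->
  (forall x, p < x < q -> {for x, continuous f}) ->
  (forall x, p < x < q -> is_derive x 1 F (f x)) ->
  {for p, continuous F} -> {for q, continuous F} ->
  has_integral `]p, q[ f (F q - F p).
Proof.
move=> pq f0 cf dF Fp Fq.
(* One third of the length keeps the two moving end points in order, since the harmonic factor is at
   most 1. *)
pose d := (q - p) / 3; have d0 : 0 < d by rewrite /d; lra.
have ch : d * harmonic n @[n --> \oo] --> (0 : R).
  by rewrite -[X in _ --> X](mulr0 d); apply: cvgMl_tmp; exact: cvg_harmonic.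
have cu : p + d * harmonic n @[n --> \oo] --> p.
  by rewrite -[X in _ --> X](addr0 p); apply: cvgD => //; exact: cvg_cst.
have cw : q - d * harmonic n @[n --> \oo] --> q.
  by rewrite -[X in _ --> X](subr0 q); apply: cvgB => //; exact: cvg_cst.
apply: (@has_integral_exhaustion _ _ F (fun n => p + d * harmonic n)
  (fun n => q - d * harmonic n)).
- exact: interval_open.
- by move=> x /=; rewrite in_itv /=; exact: f0.
- by move=> x /=; rewrite in_itv /=; exact: cf.
- by move=> m n mn; rewrite lerD2l ler_pM2l// harmonic_ni.
- by move=> m n mn; rewrite lerD2l lerN2 ler_pM2l// harmonic_ni.
- move=> n; have /andP[h0 h1] := harmonic01 n.
  have := ler_piMr (ltW d0) h1; rewrite /d; lra.
- move=> n x /=; rewrite !in_itv /=; have /andP[h0 h1] := harmonic01 n.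
  by move: (mulr_gt0 d0 h0) => /=; move: (d / _) => h; lra.
- move=> x /=; rewrite in_itv /= => /andP[px xq].
  near=> n; apply/andP; split; near: n.
    exact: cvgr_le cu _ px.
  exact: cvgr_ge cw _ xq.
- exact: continuous_cvg.
- exact: continuous_cvg.
Unshelve. all: by end_near. Qed.

Lemma has_integral_oy f F (p l : R) :
  (forall x, p < x -> 0 <= f x) ->
  (forall x, p < x -> {for x, continuous f}) ->
  (forall x, p < x -> is_derive x 1 F (f x)) ->
  {for p, continuous F} -> F x @[x --> +oo] --> l ->
  has_integral `]p, +oo[ f (l - F p).
Proof.
move=> f0 cf dF Fp Fl.
have cu : p + harmonic n @[n --> \oo] --> p.
  by rewrite -[X in _ --> X](addr0 p); apply: cvgD; [exact: cvg_cst|exact: cvg_harmonic].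
(* The shift by 2 keeps this end point beyond the left one, which is at most p + 1. *)
have cw : p + n.+2%:R @[n --> \oo] --> +oo.
  apply/cvgryPge => r; near=> n.
  rewrite -lerBlDl (@le_trans _ _ n%:R)// ?ler_nat ?leqW//.
  by near: n; exact: nbhs_infty_ger.
apply: (@has_integral_exhaustion _ _ F (fun n => p + harmonic n)
  (fun n => p + n.+2%:R)).
- exact: interval_open.
- by move=> x /=; rewrite in_itv /= andbT; exact: f0.
- by move=> x /=; rewrite in_itv /= andbT; exact: cf.
- by move=> x /=; rewrite in_itv /= andbT; exact: dF.
- by move=> m n mn; rewrite lerD2l harmonic_ni.
- by move=> m n mn; rewrite lerD2l ler_nat.
- move=> n; rewrite ltrD2l; have /andP[_ /le_lt_trans] := harmonic01 n; apply.
  by rewrite ltr1n.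
- move=> n x /=; rewrite !in_itv /= andbT.
  by have /= := harmonic01 n; move: (_^-1) => h; lra.
- move=> x /=; rewrite in_itv /= andbT => px.
  near=> n; apply/andP; split; near: n.
    exact: cvgr_le cu _ px.
  by move/cvgryPge : cw; apply.
- exact: continuous_cvg.
- by move/cvg_pinftyP : Fl; apply.
Unshelve. all: by end_near. Qed.

(** Transfers the criteria above, stated for nonnegative integrands, to nonpositive ones. *)
Lemma has_integralN D f v : measurable D ->
  has_integral D (fun x => - f x) v -> has_integral D f (- v).
Proof.
move=> mD [If <-].
have If' : mu.-integrable D (EFin \o f).
  by apply: eq_integrable (integrableN If) => // x _ /=; rewrite opprK.
split => //.
rewrite -mulN1r -RintegralZl//; apply: eq_Rintegral => x _.
by rewrite mulN1r opprK.
Qed.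

Lemma eq_has_integral D f g v : measurable D ->
  (forall x, D x -> f x = g x) -> has_integral D f v -> has_integral D g v.
Proof.
move=> mD fg [If <-]; split.
  by apply: eq_integrable If => // x; rewrite inE /= => /fg ->.
by apply: eq_Rintegral => x; rewrite inE => /fg ->.
Qed.

Lemma has_integral_setU (A B : set R) f v w : measurable A -> measurable B ->
  [disjoint A & B] ->
  has_integral A f v -> has_integral B f w -> has_integral (A `|` B) f (v + w).
Proof.
move=> mA mB AB [/[dup] IA /integrableP[mfA fA] <-].
move=> [/[dup] IB /integrableP[mfB fB] <-].
have IAB : mu.-integrable (A `|` B) (EFin \o f).
  have mf : measurable_fun (A `|` B) (EFin \o f) by apply/measurable_funU.
  apply/integrableP; split => //.
  rewrite ge0_integral_setU//; last exact: measurableT_comp.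
  exact: lte_add_pinfty.
by split => //; rewrite Rintegral_setU.
Qed.

Lemma has_integral_set1 f (m : R) : has_integral [set m] f 0.
Proof.
split; last exact: Rintegral_set1.
apply/integrableP; split; first exact: measurable_fun_set1.
by rewrite integral_set1.
Qed.

(** The dividing point is null, so [f] may be singular at [m]. *)
Lemma has_integral_cat f (a b : itv_bound R) (m v w : R) :
  (a <= BLeft m)%O -> (BRight m <= b)%O ->
  has_integral [set` Interval a (BLeft m)] f v ->
  has_integral [set` Interval (BRight m) b] f w ->
  has_integral [set` Interval a b] f (v + w).
Proof.
move=> am mb If Ig.
have mm : (BLeft m <= BRight m :> itv_bound R)%O by rewrite bnd_simp.
rewrite (itv_bndbnd_setU am (le_trans mm mb)) (itv_bndbnd_setU mm mb) set_itv1.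
apply: has_integral_setU => //.
- by apply: measurableU => //.
- apply/disj_setPS => x [] /=; rewrite in_itv /= => /andP[_ xm] [xm'|].
    by move: xm; rewrite xm' ltxx.
  by rewrite in_itv /= => /andP[mx _]; move: (lt_trans mx xm); rewrite ltxx.
- rewrite -[w]add0r; apply: has_integral_setU => //; last exact: has_integral_set1.
  by apply/disj_setPS => x [] /= ->; rewrite in_itv /= ltxx.
Qed.

End has_integral.

(** * The real part, through the substitution t = x / (1 + x) *)

Section real_part.
Context {R : realType}.
Implicit Types a x : R.

(** The new variable t = x / (1 + x), in a form whose derivative and limit at infinity are
    immediate. *)
Definition unitize x : R := 1 - (1 + x)^-1.

Lemma is_derive_unitize x : -1 < x -> is_derive x 1 unitize ((1 + x) ^- 2).
Proof.
move=> x1; have x0 : 1 + x != 0 by apply: lt0r_neq0; lra.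
have d1 : is_derive x 1 (fun y : R => 1 + y) (0 + 1) by exact: is_deriveD.
have d2 := @is_deriveV _ (fun y : R => 1 + y) x _ 1 x0 d1.
have d3 := is_deriveB (is_derive_cst (1 : R) x 1) d2.
apply: (is_derive_eq d3).
by rewrite /GRing.scale /= !add0r mulr1 opprK.
Qed.

Lemma continuous_unitize x : -1 < x -> {for x, continuous unitize}.
Proof.
move=> x1; apply/differentiable_continuous/derivable1_diffP.
by have [] := is_derive_unitize x1.
Qed.

Lemma unitize0 : unitize 0 = 0. Proof. by rewrite /unitize addr0 invr1 subrr. Qed.

Lemma unitizeE x : -1 < x -> unitize x = x / (1 + x).
Proof. by move=> x1; rewrite /unitize; field; lra. Qed.

Lemma unitize_ge0_lt1 x : 0 <= x -> 0 <= unitize x < 1.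
Proof.
move=> x0; rewrite unitizeE; last by lra.
by rewrite divr_ge0 ?ltr_pdivrMr; lra.
Qed.

Lemma unitize_gt0 x : 0 < x -> 0 < unitize x.
Proof. by move=> x0; rewrite unitizeE ?divr_gt0; lra. Qed.

Lemma cvg_unitize : unitize x @[x --> +oo] --> (1 : R).
Proof.
rewrite -[X in _ --> X](subr0 1); apply: cvgB; first exact: cvg_cst.
apply/gtr0_cvgV0.
  by near=> x; rewrite addr_gt0//.
by apply: cvg_addrl.
Unshelve. all: by end_near. Qed.

Lemma one_sub_unitize a x : -1 < x -> 1 - (1 - a) * unitize x = (1 + a * x) / (1 + x).
Proof. by move=> x1; rewrite unitizeE//; field; lra. Qed.

(** With t = [unitize x], ln |1 + a x| splits as ln |1 - (1 - a) t| - ln |1 - t|, and each term is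
    integrated against dt / t. *)
Definition primitive a x : R := Li2_refl ((1 - a) * unitize x) - Li2_refl (unitize x).

Lemma Li2_0 : Li2 0 = 0 :> R.
Proof.
apply/cvg_lim => //; rewrite (_ : (fun N => _) = fun=> 0); first exact: cvg_cst.
apply/funext => N; rewrite big1_seq// => i.
rewrite mem_index_iota => /andP[_ /andP[i0 _]].
by rewrite expr0n gtn_eqF// mul0r.
Qed.

Lemma Li2_refl1 : Li2_refl 1 = 0 :> R.
Proof.
by rewrite /Li2_refl /log_prod normr1 ln1 mul0r add0r subrr Li2_0.
Qed.

Lemma primitive0 a : primitive a 0 = 0.
Proof. by rewrite /primitive unitize0 mulr0 subrr. Qed.

(** As 1 - a < 2 and t < 1, both arguments stay in [0, 2[. The singular point 1 + a x = 0 is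
    included: it corresponds to (1 - a) t = 1. *)
Lemma continuous_primitive a x : -1 < a <= 1 -> 0 <= x ->
  {for x, continuous (primitive a)}.
Proof.
move=> /andP[a1 a2] x0; have /andP[c0 c1] := unitize_ge0_lt1 x0.
have cc : {for x, continuous unitize} by apply: continuous_unitize; lra.
apply: cvgB; last first.
  apply: (@continuous_comp _ _ _ unitize (@Li2_refl R)) => //.
  by apply: continuous_Li2_refl; rewrite ger0_norm//; lra.
apply: (@continuous_comp _ _ _ (fun y : R => (1 - a) * unitize y) (@Li2_refl R)).
  exact: cvgMl_tmp.
apply: continuous_Li2_refl; rewrite ger0_norm; nra.
Qed.

(** As t tends to 1, the limit is [Li2_refl (1 - a)] minus [Li2_refl 1], which is 0; for a = 1 this
    uses continuity of [Li2_refl] at 0. *)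
Lemma cvg_primitive a : -1 < a <= 1 ->
  primitive a x @[x --> +oo] --> ln `|a| * ln (1 - a) + Li2 a.
Proof.
move=> /andP[a1 a2].
have -> : ln `|a| * ln (1 - a) + Li2 a = Li2_refl ((1 - a) * 1) - Li2_refl 1.
  rewrite Li2_refl1 subr0 mulr1 /Li2_refl log_prodB1 /log_prod.
  by rewrite (@ger0_norm _ (1 - a)) ?subKr; lra.
apply: cvgB.
  apply: (@continuous_cvg _ _ _ _ _ (fun y : R => (1 - a) * unitize y) (@Li2_refl R)).
    by apply: continuous_Li2_refl; rewrite ger0_norm; lra.
  by apply: cvgMl_tmp; exact: cvg_unitize.
apply: (@continuous_cvg _ _ _ _ _ unitize (@Li2_refl R)); last exact: cvg_unitize.
by apply: continuous_Li2_refl; rewrite normr1; lra.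
Qed.

Lemma is_derive_primitive a x : -1 < a <= 1 -> 0 < x -> 1 + a * x != 0 ->
  is_derive x 1 (primitive a) (ln `|1 + a * x| / (x * (1 + x))).
Proof.
move=> /andP[a1 a2] x0 ax; have x1 : -1 < x by lra.
have /andP[_ c1] := unitize_ge0_lt1 (ltW x0); have c0 := unitize_gt0 x0.
have xN : x != 0 by rewrite gt_eqF.
have x1N : 1 + x != 0 by rewrite gt_eqF//; lra.
have dcv := is_derive_unitize x1.
have dR : is_derive (unitize x) 1 (@Li2_refl R) (ln `|1 - unitize x| / unitize x).
  by apply: is_derive_Li2_refl; [lra|rewrite lt_eqF].
have d2 := @is_derive1_comp _ (@Li2_refl R) unitize x _ _ dR dcv.
have d1 : is_derive x 1 (fun y : R => Li2_refl ((1 - a) * unitize y))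
    (ln `|1 - (1 - a) * unitize x| / unitize x * (1 + x) ^- 2).
  (* For a = 1 the argument is constantly 0, outside the range of [is_derive_Li2_refl], but the
     function is then constant. *)
  have [a1'|a1'] := eqVneq a 1.
    rewrite a1' subrr mul0r subr0 normr1 ln1 mul0r mul0r.
    under eq_fun do rewrite mul0r.
    exact: is_derive_cst.
  have aN : 1 - a != 0 by rewrite subr_eq0 eq_sym.
  have a0 : 0 < 1 - a by rewrite lt0r aN; lra.
  have dm := is_deriveZ (1 - a) dcv.
  have dL : is_derive ((1 - a) * unitize x) 1 (@Li2_refl R)
      (ln `|1 - (1 - a) * unitize x| / ((1 - a) * unitize x)).
    apply: is_derive_Li2_refl; first by rewrite mulr_gt0//=; nra.
    by rewrite eq_sym -subr_eq0 one_sub_unitize// mulf_neq0// invr_eq0.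
  have := @is_derive1_comp _ (@Li2_refl R) (fun y : R => (1 - a) * unitize y) x _ _ dL dm.
  move/is_derive_eq; apply.
  rewrite /GRing.scale /=; field.
  by rewrite x1N aN gt_eqF.
apply: (is_derive_eq (is_deriveB d1 d2)).
(* The second logarithm is the case a = 0 of the same identity, so the terms ln (1 / (1 + x))
   cancel. *)
rewrite one_sub_unitize// -[X in 1 - X](mul1r (unitize x)).
rewrite -[X in X * unitize x](subr0 1) one_sub_unitize//.
rewrite !normrM mul0r addr0 normr1 mul1r normfV (@gtr0_norm _ (1 + x)); last by lra.
rewrite lnM ?posrE ?normr_gt0// ?invr_gt0; last by lra.
rewrite unitizeE//; move: (ln _) (ln _) => l1 l2.
by field; rewrite xN x1N.
Qed.

Lemma continuous_integrand a x : 0 < x -> 1 + a * x != 0 ->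
  {for x, continuous (fun y : R => ln `|1 + a * y| / (y * (1 + y)))}.
Proof.
move=> x0 ax.
have c1 (b : R) : {for x, continuous (fun y : R => 1 + b * y)}.
  by apply: cvgD; [exact: cvg_cst|apply: cvgMl_tmp; exact: cvg_id].
apply: cvgM.
  apply: (@continuous_comp _ _ _ (fun y : R => 1 + a * y) (fun y : R => ln `|y|)) => //.
  exact: continuous_ln_norm.
apply: cvgV; first by rewrite mulf_neq0 ?gt_eqF//; lra.
apply: cvgM; first exact: cvg_id.
by apply: cvgD; [exact: cvg_cst|exact: cvg_id].
Qed.

Lemma has_integral_log_abs a : -1 < a <= 1 ->
  has_integral `]0, +oo[ (fun x : R => ln `|1 + a * x| / (x * (1 + x)))
    (ln `|a| * ln (1 - a) + Li2 a).
Proof.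
move=> ha; have /andP[a1 a2] := ha.
have cF x : 0 <= x -> {for x, continuous (primitive a)}.
  exact: continuous_primitive.
have den x : 0 < x -> 0 < x * (1 + x) by move=> x0; rewrite mulr_gt0//; lra.
(* For a >= 0 the integrand is nonnegative on the whole half-line. *)
have [a0|a0] := leP 0 a.
  rewrite -[X in has_integral _ _ X]subr0 -[X in _ - X](primitive0 a).
  have ax x : 0 < x -> 1 <= 1 + a * x by move=> x0; rewrite lerDl mulr_ge0// ltW.
  have axN x : 0 < x -> 1 + a * x != 0.
    by move=> /ax h; rewrite gt_eqF//; lra.
  apply: (@has_integral_oy _ _ (primitive a)).
  - move=> x x0; rewrite divr_ge0 ?(ltW (den _ x0))// ln_ge0//.
    by rewrite (le_trans (ax _ x0))// ler_norm.
  - by move=> x x0; apply: continuous_integrand => //; exact: axN.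
  - by move=> x x0; apply: is_derive_primitive => //; exact: axN.
  - exact: cF.
  - exact: cvg_primitive.
(* The integrand is singular at m, nonpositive before k and nonnegative after. *)
pose m := - a^-1; pose k := 2 * m.
have ma : a * m = -1 by rewrite /m mulrN divff// lt_eqF.
have m0 : 0 < m by rewrite oppr_gt0 invr_lt0.
have mk : m < k by rewrite /k; lra.
have ax_gt0 x : x < m -> 0 < 1 + a * x by move=> xm; nra.
have ax_lt0 x : m < x -> 1 + a * x < 0 by move=> xm; nra.
(* Where |1 + a x| <= 1 the logarithm is nonpositive, so the criterion is applied to the opposite
   function. *)
have piece (p q : R) : 0 <= p -> p < q ->
    (forall x, p < x < q -> 1 + a * x != 0) ->
    (forall x, p < x < q -> `|1 + a * x| <= 1) ->
    has_integral `]p, q[ (fun x : R => ln `|1 + a * x| / (x * (1 + x)))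
      (primitive a q - primitive a p).
  move=> p0 pq axN axle; rewrite -[X in has_integral _ _ X]opprK opprB.
  have -> : primitive a p - primitive a q = - primitive a q - - primitive a p.
    by rewrite opprK addrC.
  apply: has_integralN => //.
  have dN x : p < x < q -> is_derive x 1 (fun y => - primitive a y)
      (- (ln `|1 + a * x| / (x * (1 + x)))).
    move=> xpq; apply: is_deriveN.
    by apply: is_derive_primitive => //; [lra|exact: axN].
  apply: (has_integral_oo pq _ _ dN).
  - move=> x xpq; rewrite -mulNr divr_ge0 ?oppr_ge0//.
      by apply: ln_le0; exact: axle.
    by rewrite ltW// den; lra.
  - move=> x xpq; apply: cvgN; apply: continuous_integrand; [lra|exact: axN].
  - by apply: cvgN; exact: cF.
  - by apply: cvgN; apply: cF; lra.
have tail : has_integral `]k, +oo[ (fun x : R => ln `|1 + a * x| / (x * (1 + x)))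
    (ln `|a| * ln (1 - a) + Li2 a - primitive a k).
  apply: (@has_integral_oy _ _ (primitive a)).
  - move=> x kx; rewrite divr_ge0 ?(ltW (den _ _))//; last by lra.
    rewrite ln_ge0// ltr0_norm; last by apply: ax_lt0; lra.
    by rewrite /k in kx; nra.
  - move=> x kx; apply: continuous_integrand; first by lra.
    by rewrite lt_eqF// ax_lt0//; lra.
  - move=> x kx; apply: is_derive_primitive => //; first by lra.
    by rewrite lt_eqF// ax_lt0//; lra.
  - by apply: cF; lra.
  - exact: cvg_primitive.
have p1 : has_integral `]0, m[ (fun x : R => ln `|1 + a * x| / (x * (1 + x)))
    (primitive a m - primitive a 0).
  apply: piece => // x /andP[x0 xm]; first by rewrite gt_eqF// ax_gt0.
  by rewrite gtr0_norm ?ax_gt0//; nra.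
have p2 : has_integral `]m, k[ (fun x : R => ln `|1 + a * x| / (x * (1 + x)))
    (primitive a k - primitive a m).
  apply: piece => //; first by lra.
    by move=> x /andP[x0 xm]; rewrite lt_eqF// ax_lt0.
  by move=> x /andP[x0 xm]; rewrite ltr0_norm ?ax_lt0//; rewrite /k in xm; nra.
have p3 := has_integral_cat _ _ p2 tail.
have p4 := has_integral_cat _ _ p1 (p3 _ _).
(* The boundary values at [m] and [k] telescope. *)
suff <- : primitive a m - primitive a 0 + (primitive a k - primitive a m +
    (ln `|a| * ln (1 - a) + Li2 a - primitive a k)) = ln `|a| * ln (1 - a) + Li2 a.
  by apply: p4; rewrite !bnd_simp// ltW.
by rewrite primitive0; ring.
Qed.

End real_part.

(** * The imaginary part, produced by the jump of the argument at -1 / a *)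

Section imaginary_part.
Context {R : realType}.
Implicit Types a x : R.

(** A primitive is pi ln t with t = x / (1 + x): it tends to 0 at infinity, and t = 1 / (1 - a) at x
    = -1 / a. *)
Lemma has_integral_arg_jump a : -1 < a < 0 ->
  has_integral `](- a^-1), +oo[ (fun x : R => pi / (x * (1 + x)))
    (pi * ln (1 - a)).
Proof.
move=> /andP[a1 a0]; set m := - a^-1.
have m0 : 0 < m by rewrite oppr_gt0 invr_lt0.
have -> : pi * ln (1 - a) = 0 - pi * ln `|unitize m|.
  rewrite sub0r -mulrN; congr (_ * _).
  rewrite gtr0_norm ?unitize_gt0// -lnV ?posrE ?unitize_gt0//; congr ln.
  rewrite unitizeE; last by lra.
  by rewrite /m; field; rewrite lt_eqF//=; lra.
have dln x : 0 < x -> is_derive x 1 (fun y : R => pi * ln `|unitize y|)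
    (pi / (x * (1 + x))).
  move=> x0; have x1 : -1 < x by lra.
  have c0 : unitize x != 0 by rewrite gt_eqF// unitize_gt0.
  have dl := is_derive1_ln_norm_comp c0 (is_derive_unitize x1).
  apply: (is_derive_eq (is_deriveZ pi dl)).
  rewrite /GRing.scale /= unitizeE//; field.
  by rewrite !gt_eqF//; lra.
apply: (@has_integral_oy _ _ (fun y : R => pi * ln `|unitize y|)).
- by move=> x mx; rewrite divr_ge0 ?pi_ge0// mulr_ge0//; lra.
- move=> x mx; apply: cvgMl_tmp; apply: cvgV; first by rewrite mulf_neq0 ?gt_eqF//; lra.
  apply: cvgM; first exact: cvg_id.
  by apply: cvgD; [exact: cvg_cst|exact: cvg_id].
- by move=> x mx; apply: dln; lra.
- apply/differentiable_continuous/derivable1_diffP.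
  by have [] := dln m m0.
- rewrite -[X in _ --> X](mulr0 pi); apply: cvgMl_tmp.
  rewrite -(@ln1 R) -[X in ln X](normr1 R).
  apply: (@continuous_cvg _ _ _ _ _ unitize (fun y : R => ln `|y|));
    last exact: cvg_unitize.
  exact: continuous_ln_norm.
Qed.

Lemma has_integral0 (D : set R) : measurable D -> has_integral D (fun=> 0) 0.
Proof.
move=> mD; split; first exact: integrable0.
by rewrite Rintegral_cst// mul0r.
Qed.

Lemma Carg_pos x : 0 < x -> Carg x%:C = 0.
Proof. by move=> /Clog_pos; rewrite /Clog => -[_ ->]. Qed.

Lemma Carg_neg x : x < 0 -> Carg x%:C = pi.
Proof.
by move=> /Clog_neg; rewrite /Clog; simpc => -[_ ->].
Qed.

Lemma normc_real x : Normc.normc x%:C = `|x|.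
Proof. by rewrite /Normc.normc /= expr0n addr0 sqrtr_sqr. Qed.

Lemma integrandE a x :
  integrand a x =
    (ln `|1 + a * x| / (x * (1 + x))) +i* (Carg (1 + a * x)%:C / (x * (1 + x))).
Proof.
rewrite /integrand /Clog normc_real -fmorphV /=.
by simpc.
Qed.

Lemma has_integral_Carg a : -1 < a <= 1 ->
  has_integral `]0, +oo[ (fun x : R => Carg (1 + a * x)%:C / (x * (1 + x)))
    (Carg a%:C * ln (1 - a)).
Proof.
move=> /andP[a1 _]; have [a0|a0] := leP 0 a.
  have -> : Carg a%:C * ln (1 - a) = 0.
    (* At a = 0 the default value of [Carg] is multiplied by ln 1 = 0. *)
    have [->|aN] := eqVneq a 0; first by rewrite subr0 ln1 mulr0.
    by rewrite Carg_pos ?mul0r// lt0r aN.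
  apply: eq_has_integral (has_integral0 _) => // x; rewrite /= in_itv /= andbT => x0.
  by rewrite Carg_pos ?mul0r// ltr_wpDr// mulr_ge0// ltW.
have m0 : 0 < - a^-1 by rewrite oppr_gt0 invr_lt0.
have ma : a * - a^-1 = -1 by rewrite mulrN divff// lt_eqF.
rewrite Carg_neg// -[X in has_integral _ _ X]add0r.
apply: (has_integral_cat (m := - a^-1)); rewrite ?bnd_simp//.
  apply: eq_has_integral (has_integral0 _) => // x; rewrite /= in_itv /= => xm.
  by rewrite Carg_pos ?mul0r//; nra.
apply: eq_has_integral (has_integral_arg_jump _) => //; last by rewrite a1.
move=> x; rewrite /= in_itv /= andbT => xm.
by rewrite Carg_neg//; nra.
Qed.

(** The formula covers both exceptional values: ln (1 - a) is ln 1 = 0 at a = 0, and ln 0 = 0 by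
    convention at a = 1. *)
Lemma log_log1BE a : -1 < a <= 1 ->
  log_log1B a = (ln `|a| * ln (1 - a)) +i* (Carg a%:C * ln (1 - a)).
Proof.
move=> /andP[a1 a2]; rewrite /log_log1B.
have [->|aN] /= := eqVneq a 0; first by rewrite subr0 ln1 !mulr0.
have [->|aN1] /= := eqVneq a 1; first by rewrite subrr (@ln0 _ 0)// !mulr0.
have a3 : 0 < 1 - a by rewrite subr_gt0 lt_neqAle aN1.
rewrite (Clog_pos a3) /Clog normc_real.
by simpc.
Qed.

End imaginary_part.

Unset Implicit Arguments.

Theorem proposition4 (R : realType) (a : R) (ha : -1 < a <= 1) :
  Cintegrable (@lebesgue_measure R) `]0, +oo[ (integrand a) /\
  Cintegral (@lebesgue_measure R) `]0, +oo[ (integrand a) =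
    log_log1B a + (Li2 a)%:C.
Proof.
have -> : integrand a = fun x =>
    (ln `|1 + a * x| / (x * (1 + x))) +i* (Carg (1 + a * x)%:C / (x * (1 + x))).
  by apply/funext => x; exact: integrandE.
have [iRe eRe] := has_integral_log_abs ha.
have [iIm eIm] := has_integral_Carg ha.
split; first by split.
rewrite /Cintegral /= eRe eIm log_log1BE//.
by simpc.
Qed.
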